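(* Let $G$ be a connected simple graph of order $n>10$ and let $k$ be an integer with $2 \le k \le n-2$. Then $F_k(G)$ is planar if and only if ($k=2$ or $k=n-2$) and $G$ is isomorphic to the path $P_n$ on $n$ vertices.
   Context: For a simple graph $G=(V,E)$ on $n$ vertices and an integer $1\le k<n$, the $k$-token graph $F_k(G)$ is the graph whose vertices are all $k$-element subsets of $V$, two such subsets $A,B$ being adjacent whenever their symmetric difference $A\triangle B$ is a pair $\{a,b\}$ with $a$ adjacent to $b$ in $G$. *)

(* Defs.v *)
From Stdlib Require Import Reals.
From mathcomp Require Import all_boot.
Set Implicit Arguments. Unset Strict Implicit. Unset Printing Implicit Defensive.

Definition simple_graph (T : finType) (e : rel T) : Prop :=
  irreflexive e /\ symmetric e.

Definition connected_graph (T : finType) (e : rel T) : Prop :=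
  forall x y : T, connect e x y.

Definition token_vertex (T : finType) (k : nat) := {A : {set T} | #|A| == k}.

Definition token_rel (T : finType) (e : rel T) (k : nat) : rel (token_vertex T k) :=
  fun A B => [exists a : T, exists b : T,
     e a b && (((val A :\: val B) :|: (val B :\: val A)) == [set a; b])].

Arguments token_rel {T} e k.

Definition path_rel (n : nat) : rel 'I_n :=
  fun i j => (i.+1 == j) || (j.+1 == i).

Arguments path_rel n : clear implicits.

Definition isomorphic (T U : finType) (e : rel T) (f : rel U) : Prop :=
  exists phi : T -> U, bijective phi /\ forall x y, e x y = f (phi x) (phi y).

Local Open Scope R_scope.
Definition planar (V : finType) (r : rel V) : Prop :=
  exists (p : V -> R * R) (c : V -> V -> R -> R * R),
    injective p /\
    forall x y, r x y ->
      continuity (fun t => fst (c x y t)) /\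
      continuity (fun t => snd (c x y t)) /\
      c x y 0 = p x /\ c x y 1 = p y /\
      (forall s t, 0 <= s <= 1 -> 0 <= t <= 1 -> c x y s = c x y t -> s = t) /\
      (forall z t, 0 < t < 1 -> c x y t <> p z) /\
      (forall u v s t, r u v -> 0 < s < 1 -> 0 < t < 1 ->
         c x y s = c u v t -> (u = x /\ v = y) \/ (u = y /\ v = x)).

(* Main.v *)
(** Non-planarity is detected by an argument of van Kampen and Hanani-Tutte, modulo 2.
    For two disjoint arcs [g] and [f], the map (s, t) |-> g s - f t from the unit square
    avoids the origin, so its boundary loop crosses a half-line from the origin an even
    number of times. Summing these relations over the 18 pairs of disjoint edges of
    K_{3,3}, every crossing number occurs twice, whereas the terms that only depend on
    the positions of the vertices add up to 1. The same cancellation handles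
    subdivisions, so a planar graph contains no subdivided K_{3,3}.

    Up to complementing the k-sets, 2k <= n. If k >= 3, every tree with 7 vertices contains
    one of seven small trees whose 3-token graph contains a subdivided K_{3,3}. If k = 2
    and some vertex has three neighbours, the tree grown from this claw up to 11 vertices
    contains one of five small trees whose 2-token graph does. Otherwise G is a path or
    a cycle; F_2(C_{n+1}) contains a subdivision of F_2(C_n), and F_2(C_6) contains a
    subdivided K_{3,3}. Conversely, sending {i < j} to the point (i, j) embeds F_2(P_n) into
    the square grid. *)
From mathcomp Require Import all_boot.
From Stdlib Require Import Reals Lra Classical ClassicalEpsilon Ring.
From Coquelicot Require Import Rcomplements Compactness.
From Coquelicot Require Hierarchy.
Require Import Defs.
Set Implicit Arguments. Unset Strict Implicit. Unset Printing Implicit Defensive.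
Local Open Scope nat_scope.

(** * The parity obstruction *)

Lemma addb_xorb b c : b (+) c = xorb b c. Proof. by case: b; case: c. Qed.

Lemma xorbK b c : xorb (xorb b c) c = b. Proof. by case: b; case: c. Qed.

Lemma xorbb b : xorb b b = false. Proof. by case: b. Qed.

(* [ring_simplify] sorts the monomials but leaves the repeated ones in place. *)
Ltac xor_tauto :=
  rewrite !addb_xorb; ring_simplify; rewrite ?(xorbK, xorbb); reflexivity.

Lemma addb_eq0 b c : b = c -> b (+) c = false.
Proof. by move->; rewrite addbb. Qed.

Lemma eq_addb0 b c : b (+) c = false -> b = c.
Proof. by case: b; case: c. Qed.

(* For a drawing, [h u v] tells whether the vector from v to u lies in the upper
   half-plane, and [N v a b] is the parity of the number of times the edge a b crosses
   the horizontal half-line to the right of v. *)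
Definition parity_drawing (V : countType) (r : rel V) : Prop :=
  exists (h : V -> V -> bool) (N : V -> V -> V -> bool),
    (forall u v, u != v -> h u v = ~~ h v u) /\
    (forall a b c d, r a b -> r c d ->
       a != c -> a != d -> b != c -> b != d ->
       N c a b (+) N d a b (+) (N a c d (+) N b c d) =
       h a c (+) h a d (+) (h b c (+) h b d)).

(** Each edge is oriented from left to right, so it is listed once. Indices from 3 on are isolated
    vertices, and integer indices give a countable vertex type. *)
Definition K33_rel (u v : nat + nat) : bool :=
  match u, v with inl i, inr j => (i < 3) && (j < 3) | _, _ => false end.

Lemma K33_no_parity_drawing : ~ parity_drawing K33_rel.
Proof.
move=> [h [N [hN rel]]].
pose R i j k l := N (inl k) (inl i) (inr j) (+) N (inr l) (inl i) (inr j)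
  (+) (N (inl i) (inl k) (inr l) (+) N (inr j) (inl k) (inr l))
  (+) (h (inl i) (inl k) (+) h (inl i) (inr l)
       (+) (h (inr j) (inl k) (+) h (inr j) (inr l))).
have R0 i j k l : i < 3 -> j < 3 -> k < 3 -> l < 3 -> i != k -> j != l ->
    R i j k l = false.
  by move=> *; apply/addb_eq0/rel => //=; apply/andP.
(* The six pairs of disjoint edges with left ends [i] and [k]; the three choices of these ends make
   up all 18 pairs. *)
pose R2 i k := R i 0 k 1 (+) R i 1 k 0 (+) (R i 0 k 2 (+) R i 2 k 0)
  (+) (R i 1 k 2 (+) R i 2 k 1).
(* Orienting all [h] terms alike flips 9 terms between right vertices and 18 terms between the two
   sides. These 27 flips are odd in number, and everything else occurs an even number of times. *)
have : R2 0 1 (+) R2 0 2 (+) R2 1 2 = true.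
  rewrite /R2 /R (hN (inr 1) (inr 0)) // (hN (inr 2) (inr 0)) //.
  rewrite (hN (inr 2) (inr 1)) //.
  rewrite (hN (inr 0) (inl 1)) // (hN (inr 0) (inl 2)) // (hN (inr 1) (inl 1)) //.
  rewrite (hN (inr 1) (inl 2)) // (hN (inr 2) (inl 1)) // (hN (inr 2) (inl 2)) //.
  by rewrite -!addTb; xor_tauto.
by rewrite /R2 !R0.
Qed.

Fixpoint walk_sum (V : Type) (N : V -> V -> bool) (x : V) (p : seq V) : bool :=
  if p is y :: p' then N x y (+) walk_sum N y p' else false.

(** The relation is additive in each edge: when edges are concatenated, the terms at the
    intermediate vertices occur twice and cancel. First [q] is built up against one edge, then
    [p]. *)
Lemma parity_walks (V : eqType) (r : rel V) (h : V -> V -> bool)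
    (N : V -> V -> V -> bool) :
  (forall a b c d, r a b -> r c d ->
       a != c -> a != d -> b != c -> b != d ->
       N c a b (+) N d a b (+) (N a c d (+) N b c d) =
       h a c (+) h a d (+) (h b c (+) h b d)) ->
  forall a p c q, path r a p -> path r c q ->
  {in a :: p & c :: q, forall x y, x != y} ->
  walk_sum (N c) a p (+) walk_sum (N (last c q)) a p
    (+) (walk_sum (N a) c q (+) walk_sum (N (last a p)) c q) =
  h a c (+) h a (last c q) (+) (h (last a p) c (+) h (last a p) (last c q)).
Proof.
move=> rel.
have step a b c q : r a b -> path r c q ->
    {in [:: a; b] & c :: q, forall x y, x != y} ->
    N c a b (+) N (last c q) a b (+) (walk_sum (N a) c q (+) walk_sum (N b) c q) =
    h a c (+) h a (last c q) (+) (h b c (+) h b (last c q)).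
  move=> rab; elim: q c => [|d q IH] c /=; first by rewrite !addbb.
  move=> /andP[rcd pq] D.
  have /addb_eq0 E : N c a b (+) N d a b (+) (N a c d (+) N b c d) =
      h a c (+) h a d (+) (h b c (+) h b d).
    by apply: rel => //; apply: D; rewrite !inE !eqxx ?orbT.
  have /addb_eq0 I :=
    IH d pq (fun x y xi yi => D x y xi (mem_behead (s := _ :: _) yi)).
  by apply: eq_addb0; rewrite -[RHS](congr2 addb E I); xor_tauto.
move=> a p; elim: p a => [|b p IH] a c q /=; first by rewrite !addbb.
move=> /andP[rab pp] pq D.
have /addb_eq0 E := step a b c q rab pq
  (fun x y xi yi => D x y (mem_subseq (prefix_subseq [:: a; b] p) xi) yi).
have /addb_eq0 I :=
  IH b c q pp pq (fun x y xi yi => D x y (mem_behead (s := _ :: _) xi) yi).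
by apply: eq_addb0; rewrite -[RHS](congr2 addb E I); xor_tauto.
Qed.

Lemma parity_subdivision (W V : countType) (r' : rel W) (r : rel V)
    (f : W -> V) (route : W -> W -> seq V) :
  (forall x y, r' x y ->
     path r (f x) (route x y) /\ last (f x) (route x y) = f y) ->
  (forall a b c d, r' a b -> r' c d ->
     a != c -> a != d -> b != c -> b != d ->
     {in f a :: route a b & f c :: route c d, forall x y, x != y}) ->
  parity_drawing r -> parity_drawing r'.
Proof.
move=> routeP D [h [N [hN rel]]].
(* [f] may identify vertices, so [pickle] breaks ties to keep [h] antisymmetric. Ends of edges
   without a common end have distinct images, so the relation never meets a tie. *)
exists (fun u v => if f u == f v then pickle u < pickle v else h (f u) (f v)).
exists (fun v x y => walk_sum (N (f v)) (f x) (route x y)); split=> [u v uv|].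
  rewrite (eq_sym (f v)); case: (eqVneq (f u) (f v)) => [_|/hN->//].
  rewrite -leqNgt ltn_neqAle; case: eqP => //= /(pcan_inj pickleK) E.
  by rewrite E eqxx in uv.
move=> a b c d rab rcd ac ad bc bd.
have [pab lab] := routeP _ _ rab; have [pcd lcd] := routeP _ _ rcd.
have Dab := D _ _ _ _ rab rcd ac ad bc bd.
have fa : f a \in f a :: route a b by rewrite inE eqxx.
have fc : f c \in f c :: route c d by rewrite inE eqxx.
have fb : f b \in f a :: route a b by rewrite -lab mem_last.
have fd : f d \in f c :: route c d by rewrite -lcd mem_last.
rewrite !(negPf (Dab _ _ _ _)) // -lab -lcd.
by apply: (parity_walks rel).
Qed.

(** * Crossing parities of plane curves *)

Definition posb (x : R) : bool := if Rlt_dec 0 x then true else false.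

Lemma posP (x : R) : reflect (Rlt 0 x) (posb x).
Proof. by rewrite /posb; case: Rlt_dec => H; constructor. Qed.

(** The open upper half-plane with the open positive half-axis added, so that exactly one of two
    opposite nonzero vectors is upper. *)
Definition upper (z : R * R) : bool :=
  posb z.2 || (~~ posb (- z.2)%R && posb z.1).

Definition vec (z w : R * R) : R * R := (z.1 - w.1, z.2 - w.2)%R.

(* For z and w close to each other compared to their distance to the origin:
   whether the step from z to w crosses the positive half of the first axis. *)
Definition crossing (z w : R * R) : bool := (upper z (+) upper w) && posb z.1.

Ltac pos_cases :=
  rewrite /crossing /upper /vec /=; intros;
  repeat (match goal with |- context [posb ?x] => case: (posP x) => ? end);
  rewrite //=; try (exfalso; lra).

Lemma upper_vecN z w : z <> w -> upper (vec z w) = ~~ upper (vec w z).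
Proof.
case: z w => [x y] [x' y'] zw.
have [|[|[|]]] : (x < x' \/ x' < x \/ y < y' \/ y' < y)%R; last 4 first.
- by pos_cases.
- by pos_cases.
- by pos_cases.
- by pos_cases.
case: (Req_dec x x') => [E|]; last by lra.
case: (Req_dec y y') => [E'|]; last by lra.
by case: zw; rewrite E E'.
Qed.

Definition in_half_plane (P : (R * R -> Prop)) : Prop :=
  [\/ forall z, P z -> Rlt 0 z.1, forall z, P z -> (z.1 < 0)%R,
      forall z, P z -> (0 < z.2)%R | forall z, P z -> (z.2 < 0)%R].

Lemma upper_half (P : R * R -> Prop) : in_half_plane P ->
  (forall z, P z -> Rlt 0 z.1) \/ (forall z, P z -> (z.1 < 0)%R) \/
  (exists b, forall z, P z -> upper z = b).
Proof.
case=> H; [by left|by right; left| |]; right; right; [exists true|exists false];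
  by move=> z /H; pos_cases.
Qed.

(** A closed loop in a half-plane avoiding the origin does not wind. With positive abscissas the
    crossings are changes of [upper], which cancel around the cell; with negative abscissas, or
    constant [upper], there are none. *)
Lemma crossing_cell (P : R * R -> Prop) z1 z2 z3 z4 : in_half_plane P ->
  P z1 -> P z2 -> P z3 -> P z4 ->
  crossing z1 z2 (+) crossing z3 z4 (+) (crossing z1 z3 (+) crossing z2 z4) = false.
Proof.
move=> /upper_half[H|[H|[b H]]] p1 p2 p3 p4; rewrite /crossing.
- have E z : P z -> posb z.1 by move=> /H /posP.
  by rewrite !E // !andbT; xor_tauto.
- have E z : P z -> posb z.1 = false by move=> /H Hz; case: posP => //; lra.
  by rewrite !E // !andbF.
- by rewrite !H // addbb.
Qed.

(** Negation exchanges the two halves of the first axis. A small step that changes side crosses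
    exactly one of them, so the two crossing bits differ exactly when the side changes. *)
Lemma crossing_opp (P : R * R -> Prop) (z w z' w' : R * R) : in_half_plane P ->
  P (vec z z') -> P (vec w w') ->
  crossing (vec z z') (vec w w') =
  crossing (vec z' z) (vec w' w) (+) (upper (vec z' z) (+) upper (vec w' w)).
Proof.
move=> hP p1 p2.
have ne u v : P (vec u v) -> u <> v.
  move=> Puv E; case: hP => /(_ _ Puv); rewrite E /=; lra.
have n1 := upper_vecN (ne _ _ p1); have n2 := upper_vecN (ne _ _ p2).
rewrite /crossing n1 n2 addbN addNb negbK.
case: (upper_half hP) => [|[]] H.
- have := H _ p1; rewrite /= => H1.
  have -> : posb (z.1 - z'.1) by apply/posP.
  have -> : posb (z'.1 - z.1) = false by case: posP => //; lra.
  by rewrite andbT andbF.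
- have := H _ p1; rewrite /= => H1.
  have -> : posb (z.1 - z'.1) = false by case: posP => //; lra.
  have -> : posb (z'.1 - z.1) by apply/posP; lra.
  by rewrite andbT andbF addbb.
- have [b Hb] := H; move: n1 n2; rewrite (Hb _ p1) (Hb _ p2).
  move=> /esym/(canRL negbK) -> /esym/(canRL negbK) ->.
  by rewrite !addbb.
Qed.

Definition grid_point (n i : nat) : R := (INR i / INR n)%R.

(* Parity of the crossings of [g] with the half-line to the right of [v], counted on a
   subdivision of the unit interval into [n] parts; it is meaningful for large [n]. *)
Definition crossings (v : R * R) (g : R -> R * R) (n : nat) : bool :=
  \big[addb/false]_(i < n)
    crossing (vec (g (grid_point n i)) v) (vec (g (grid_point n i.+1)) v).

Lemma telescope_addb (a : nat -> bool) n :
  \big[addb/false]_(i < n) (a i (+) a i.+1) = a 0 (+) a n.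
Proof.
elim: n => [|n IH]; first by rewrite big_ord0 addbb.
by rewrite big_ord_recr /= IH; xor_tauto.
Qed.

(** A discrete Stokes formula: summing over all cells, each inner edge of the grid belongs to two
    cells and cancels. *)
Lemma grid_boundary (H W : nat -> nat -> bool) n m :
  (forall i j, i < n -> j < m ->
     H i j (+) H i j.+1 (+) (W i j (+) W i.+1 j) = false) ->
  \big[addb/false]_(i < n) H i 0 (+) \big[addb/false]_(i < n) H i m
  (+) (\big[addb/false]_(j < m) W 0 j (+) \big[addb/false]_(j < m) W n j) = false.
Proof.
move=> cell.
rewrite -(telescope_addb (fun j => \big[addb/false]_(i < n) H i j) m).
rewrite -!big_split /=; apply: big1 => j _.
rewrite -(telescope_addb (fun i => W i j) n) -!big_split /=.
by apply: big1 => i _; apply: cell.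
Qed.

Lemma subr_gt0_near (phi psi : R -> R) (u v : R) :
  continuity phi -> continuity psi -> (0 < phi u - psi v)%R ->
  exists d : posreal, forall s t,
    (Rabs (s - u) < 2 * d)%R -> (Rabs (t - v) < 2 * d)%R -> (0 < phi s - psi t)%R.
Proof.
move=> cphi cpsi pos.
have e0 : (0 < (phi u - psi v) / 2)%R by lra.
have /Hierarchy.continuity_pt_locally/(_ (mkposreal _ e0))[d1 near1] := cphi u.
have /Hierarchy.continuity_pt_locally/(_ (mkposreal _ e0))[d2 near2] := cpsi v.
have dpos : (0 < Rmin d1 d2 / 2)%R.
  by have := Rmin_pos d1 d2 (cond_pos d1) (cond_pos d2); lra.
exists (mkposreal _ dpos) => s t /=.
have := Rmin_l d1 d2; have := Rmin_r d1 d2 => le2 le1 su tv.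
have /Rabs_def2/= : (Rabs (phi s - phi u) < (phi u - psi v) / 2)%R.
  by apply: near1; apply: Rlt_le_trans su _; lra.
have /Rabs_def2/= : (Rabs (psi t - psi v) < (phi u - psi v) / 2)%R.
  by apply: near2; apply: Rlt_le_trans tv _; lra.
lra.
Qed.

Definition continuous_arc (g : R -> R * R) : Prop :=
  continuity (fun t => (g t).1) /\ continuity (fun t => (g t).2).

(** The radius is doubled to leave room for a whole cell: one corner lies within [d] of the centre,
    and the next grid points are less than [d] further away. *)
Definition near_differences (g f : R -> R * R) (u v d : R) (z : R * R) : Prop :=
  exists s t, [/\ (Rabs (s - u) < 2 * d)%R, (Rabs (t - v) < 2 * d)%R &
                  z = vec (g s) (f t)].

Lemma near_differences_half (g f : R -> R * R) (u v : R) :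
  continuous_arc g -> continuous_arc f -> g u <> f v ->
  exists d : posreal, in_half_plane (near_differences g f u v d).
Proof.
move=> [cg1 cg2] [cf1 cf2] ne.
have [|[|[|]]] : ((g u).1 < (f v).1 \/ (f v).1 < (g u).1 \/
    (g u).2 < (f v).2 \/ (f v).2 < (g u).2)%R; last 4 first.
- move=> lt; have [|d near] := subr_gt0_near (u := v) (v := u) cf1 cg1; first lra.
  exists d; constructor 2 => _ [s [t [su tv ->]]] /=; have := near t s tv su; lra.
- move=> lt; have [|d near] := subr_gt0_near (u := u) (v := v) cg1 cf1; first lra.
  exists d; constructor 1 => _ [s [t [su tv ->]]] /=; have := near s t su tv; lra.
- move=> lt; have [|d near] := subr_gt0_near (u := v) (v := u) cf2 cg2; first lra.
  exists d; constructor 4 => _ [s [t [su tv ->]]] /=; have := near t s tv su; lra.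
- move=> lt; have [|d near] := subr_gt0_near (u := u) (v := v) cg2 cf2; first lra.
  exists d; constructor 3 => _ [s [t [su tv ->]]] /=; have := near s t su tv; lra.
case: (Req_dec (g u).1 (f v).1) => [E|]; last by lra.
case: (Req_dec (g u).2 (f v).2) => [E'|]; last by lra.
by case: ne; rewrite (surjective_pairing (g u)) E E' -surjective_pairing.
Qed.

Lemma grid_point0 n : grid_point n 0 = 0%R.
Proof. by rewrite /grid_point /=; lra. Qed.

Lemma grid_pointn n : 0 < n -> grid_point n n = 1%R.
Proof. by move=> n0; apply: Rinv_r; apply: not_0_INR; case: n n0. Qed.

Lemma grid_point_itv n i : i <= n -> 0 < n -> (0 <= grid_point n i <= 1)%R.
Proof.
move=> /leP/le_INR le_in /ltP/lt_0_INR n0; rewrite /grid_point; split.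
  by apply: Rdiv_le_0_compat => //; apply: pos_INR.
by apply: (Rmult_le_reg_r (INR n)) => //; field_simplify; lra.
Qed.

Lemma grid_pointS n i : grid_point n i.+1 = (grid_point n i + / INR n)%R.
Proof. by rewrite /grid_point S_INR; lra. Qed.

Lemma disjoint_arcs_crossings (g f : R -> R * R) :
  continuous_arc g -> continuous_arc f ->
  (forall s t, 0 <= s <= 1 -> 0 <= t <= 1 -> g s <> f t)%R ->
  exists n0, forall n, n0 <= n ->
    crossings (f 0%R) g n (+) crossings (f 1%R) g n
      (+) (crossings (g 0%R) f n (+) crossings (g 1%R) f n) =
    upper (vec (g 0%R) (f 0%R)) (+) upper (vec (g 0%R) (f 1%R))
      (+) (upper (vec (g 1%R) (f 0%R)) (+) upper (vec (g 1%R) (f 1%R))).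
Proof.
move=> cg cf disj.
have half u v : exists d : posreal, (0 <= u <= 1)%R -> (0 <= v <= 1)%R ->
    in_half_plane (near_differences g f u v d).
  case: (classic (0 <= u <= 1 /\ 0 <= v <= 1)%R) => [[Iu Iv]|nI].
    by have [d] := near_differences_half cg cf (disj u v Iu Iv); exists d.
  (* Outside the unit square the radius is a dummy value that makes [delta] total. *)
  by exists (mkposreal 1 Rlt_0_1) => *; case: nI.
pose delta u v := proj1_sig (constructive_indefinite_description _ (half u v)).
have [d cover] := compactness_value_2d 0 1 0 1 delta.
have [n0 n0d] : exists n0, 0 < n0 /\ (/ INR n0 < d)%R.
  have [n [nd n0]] := archimed_cor1 d (cond_pos d).
  by exists n; split=> //; apply/ltP.
case: n0d => n0_gt0 n0d; exists n0 => n n0n.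
have n_gt0 : 0 < n by apply: leq_trans n0n.
have nd : (0 < / INR n < d)%R.
  have pos0 : (0 < INR n0)%R by apply/lt_0_INR/ltP.
  have le_n : (INR n0 <= INR n)%R by apply/le_INR/leP.
  split; first by apply: Rinv_0_lt_compat; lra.
  by apply: Rle_lt_trans n0d; apply: Rinv_le_contravar.
pose z i j := vec (g (grid_point n i)) (f (grid_point n j)).
have cell i j : i < n -> j < n -> exists2 P, in_half_plane P &
    [/\ P (z i j), P (z i.+1 j), P (z i j.+1) & P (z i.+1 j.+1)].
  move=> lt_in lt_jn.
  have Ii := grid_point_itv (ltnW lt_in) n_gt0.
  have Ij := grid_point_itv (ltnW lt_jn) n_gt0.
  (* Compactness provides the centre only under a double negation. *)
  have [u [v [Iu [Iv [/Rabs_def2 iu [/Rabs_def2 jv dd]]]]]] := NNPP _ (cover _ _ Ii Ij).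
  exists (near_differences g f u v (delta u v)).
    exact: proj2_sig (constructive_indefinite_description _ (half u v)) Iu Iv.
  by split; (do 2 eexists; split; last reflexivity); rewrite ?grid_pointS;
    apply: Rabs_def1; lra.
have boundary : \big[addb/false]_(i < n) crossing (z i 0) (z i.+1 0) (+)
      \big[addb/false]_(i < n) crossing (z i n) (z i.+1 n) (+)
      (\big[addb/false]_(j < n) crossing (z 0 j) (z 0 j.+1) (+)
       \big[addb/false]_(j < n) crossing (z n j) (z n j.+1)) = false.
  apply: (@grid_boundary (fun i j => crossing (z i j) (z i.+1 j))
                         (fun i j => crossing (z i j) (z i j.+1))) => i j lt_in lt_jn.
  have [P hP [P00 P10 P01 P11]] := cell i j lt_in lt_jn.
  exact: (crossing_cell hP).
(* On these sides [z] is g s - f t, while [crossings] counts along f t - g s. [crossing_opp]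
   corrects each step, and the corrections telescope to the two ends of [f]. *)
have side i : i <= n -> \big[addb/false]_(j < n) crossing (z i j) (z i j.+1) =
   crossings (g (grid_point n i)) f n (+)
     (upper (vec (f 0%R) (g (grid_point n i))) (+)
      upper (vec (f 1%R) (g (grid_point n i)))).
  move=> le_in; rewrite -(grid_point0 n) -(grid_pointn n_gt0).
  rewrite -(telescope_addb
    (fun j => upper (vec (f (grid_point n j)) (g (grid_point n i))))).
  rewrite -big_split; apply: eq_bigr => -[j lt_jn] _ /=.
  have [P hP [Pj PS]] : exists2 P, in_half_plane P & P (z i j) /\ P (z i j.+1).
    move: le_in; rewrite leq_eqVlt => /orP[/eqP->|lt_in]; last first.
      by have [P hP []] := cell i j lt_in lt_jn; exists P.
    (* No cell starts on the last side, so the cell just before it is used. *)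
    have := cell n.-1 j; rewrite prednK // => /(_ (leqnn _) lt_jn)[P hP []].
    by exists P.
  exact: crossing_opp hP Pj PS.
move: boundary; rewrite !side // grid_point0 grid_pointn // /z grid_point0 grid_pointn //.
rewrite !(upper_vecN (z := f _)); try by apply: nesym; apply: disj; lra.
move=> boundary; apply: eq_addb0; rewrite -[RHS]boundary /crossings -!addTb.
xor_tauto.
Qed.

(** A drawing needs a single subdivision that is fine enough for all the finitely many pairs of
    edges at once. *)
Lemma uniform_threshold (I : finType) (P : I -> nat -> Prop) :
  (forall i, exists n0, forall n, n0 <= n -> P i n) -> exists n, forall i, P i n.
Proof.
move=> thr.
pose n0 i := proj1_sig (constructive_indefinite_description _ (thr i)).
exists (\max_i n0 i) => i.
apply: (proj2_sig (constructive_indefinite_description _ (thr i))).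
exact: (leq_bigmax (F := n0) i).
Qed.

Lemma planar_parity_drawing (V : finType) (r : rel V) : planar r -> parity_drawing r.
Proof.
move=> [p [c [p_inj curve]]].
pose P (q : V * V * (V * V)) n := let: (a, b, (x, y)) := q in
  r a b -> r x y -> a != x -> a != y -> b != x -> b != y ->
  crossings (p x) (c a b) n (+) crossings (p y) (c a b) n
    (+) (crossings (p a) (c x y) n (+) crossings (p b) (c x y) n) =
  upper (vec (p a) (p x)) (+) upper (vec (p a) (p y))
    (+) (upper (vec (p b) (p x)) (+) upper (vec (p b) (p y))).
have [n Pn] : exists n, forall q, P q n; last first.
  exists (fun u v => upper (vec (p u) (p v))).
  exists (fun v x y => crossings (p v) (c x y) n); split=> [u v uv|a b x y].
    by apply: upper_vecN => /p_inj E; rewrite E eqxx in uv.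
  exact: Pn (a, b, (x, y)).
apply: uniform_threshold => -[[a b] [x y]].
case: (classic (r a b /\ r x y /\ [&& a != x, a != y, b != x & b != y])); last first.
  by move=> H; exists 0 => n _ rab rxy ax ay bx by_; case: H; do 2 split=> //; apply/and4P.
move=> [rab [rxy /and4P[ax ay bx by_]]].
have [cab1 [cab2 [ab0 [ab1 [_ [ab_p ab_c]]]]]] := curve a b rab.
have [cxy1 [cxy2 [xy0 [xy1 [_ [xy_p _]]]]]] := curve x y rxy.
have pN u v : u != v -> p u <> p v by move=> /eqP uv /p_inj.
have ends t : (0 <= t <= 1)%R -> t = 0%R \/ t = 1%R \/ (0 < t < 1)%R by lra.
have disj s t : (0 <= s <= 1)%R -> (0 <= t <= 1)%R -> c a b s <> c x y t.
  move=> Is /ends[->|[->|It]].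
  - rewrite xy0; have [->|[->|/ab_p]] := ends _ Is; last exact.
      by rewrite ab0; apply: pN.
    by rewrite ab1; apply: pN.
  - rewrite xy1; have [->|[->|/ab_p]] := ends _ Is; last exact.
      by rewrite ab0; apply: pN.
    by rewrite ab1; apply: pN.
  have [->|[->|Is']] := ends _ Is.
  - by rewrite ab0; apply/nesym/xy_p.
  - by rewrite ab1; apply/nesym/xy_p.
  move=> /(ab_c _ _ _ _ rxy Is' It)[][E _]; first by rewrite E eqxx in ax.
  by rewrite E eqxx in bx.
have [n0 thr] := disjoint_arcs_crossings (conj cab1 cab2) (conj cxy1 cxy2) disj.
by exists n0 => n /thr; rewrite ab0 ab1 xy0 xy1 => E _ _ _ _ _ _; exact: E.
Qed.

(** * Token graphs on sequences *)

(* The walk of index 3 i + j joins the i-th branch vertex of one side to the j-th one of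
   the other side. Only walks without a common end have to be disjoint. *)
Definition K33_certificate (V : eqType) (x0 : V) (r : rel V) (walks : seq (seq V)) : bool :=
  let w i j := nth [::] walks (3 * i + j) in
  let a i := head x0 (w i 0) in
  let b j := last x0 (w 0 j) in
  all (fun i => all (fun j =>
    [&& w i j == a i :: behead (w i j), path r (a i) (behead (w i j)),
        last (a i) (behead (w i j)) == b j &
        all (fun k => all (fun l =>
          (i == k) || (j == l) || allrel (fun x y => x != y) (w i j) (w k l))
        (iota 0 3)) (iota 0 3)]) (iota 0 3)) (iota 0 3).

Lemma K33_certificate_no_drawing (V : countType) x0 (r : rel V) walks :
  K33_certificate x0 r walks -> ~ parity_drawing r.
Proof.
move=> cert drawing.
pose w i j := nth [::] walks (3 * i + j).
pose a i := head x0 (w i 0).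
pose b j := last x0 (w 0 j).
have certP i j : i < 3 -> j < 3 ->
    [/\ w i j = a i :: behead (w i j), path r (a i) (behead (w i j)),
        last (a i) (behead (w i j)) = b j &
        forall k l, k < 3 -> l < 3 -> i != k -> j != l ->
          {in w i j & w k l, forall x y, x != y}].
  move=> i3 j3; have mem3 k : k < 3 -> k \in iota 0 3 by rewrite mem_iota.
  have /allP/(_ i (mem3 _ i3))/allP/(_ j (mem3 _ j3)) := cert.
  case/and4P=> /eqP wE pw /eqP lw /allP dis; split=> // k l k3 l3.
  move/negPf=> ik /negPf jl; have /allP/(_ l (mem3 _ l3)) := dis k (mem3 _ k3).
  by rewrite ik jl /= => /allrelP.
apply: K33_no_parity_drawing.
pose f (u : nat + nat) := match u with inl i => a i | inr j => b j end.
pose route (u v : nat + nat) :=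
  match u, v with inl i, inr j => behead (w i j) | _, _ => [::] end.
apply: (@parity_subdivision _ _ _ _ f route) drawing.
- by move=> [i|i] [j|j] //= /andP[i3 j3]; have [] := certP i j i3 j3.
move=> [i|i] [j|j] [k|k] [l|l] //= /andP[i3 j3] /andP[k3 l3] ik _ _ jl.
have [<- _ _] := certP i j i3 j3; have [<- _ _ _] := certP k l k3 l3.
exact.
Qed.

(* The [k]-token graph of [e] on the vertices below [m], a token configuration being
   represented by its increasing enumeration. *)
Definition seq_token_rel (e : rel nat) (m k : nat) : rel (seq nat) := fun s t =>
  [&& sorted ltn s, sorted ltn t, all (gtn m) s, all (gtn m) t, size s == k &
      has (fun i => has (fun j =>
        [&& e i j, j \notin s & perm_eq t (j :: rem i s)]) t) s].

(** The copy need not be induced: further edges of [e] only add edges to the token graph. *)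
Definition copy (T : eqType) (x0 : T) (e : rel T) (g : seq T) (a : rel nat) : Prop :=
  uniq g /\ forall i j, i < size g -> j < size g -> a i j -> e (nth x0 g i) (nth x0 g j).

Lemma ex_subset_card (T : finType) (A : {set T}) n :
  n <= #|A| -> exists2 B : {set T}, B \subset A & #|B| = n.
Proof.
move=> /card_geqP[s [us <- sA]]; exists [set x in s].
  by apply/subsetP=> x; rewrite inE => /sA.
by rewrite cardsE; apply/card_uniqP.
Qed.

Lemma token_rel_swap (T : finType) (e : rel T) k (A B : token_vertex T k) a b :
  e a b -> a \in val A -> b \notin val A -> val B = b |: (val A :\ a) ->
  token_rel e k A B.
Proof.
move=> eab aA bA BE; apply/existsP; exists a; apply/existsP; exists b.
rewrite eab BE; apply/eqP/setP=> x; rewrite !inE.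
have ab : a != b by apply: contraNneq bA => <-.
case: (eqVneq x a) => [->|xa]; first by rewrite aA (negPf ab).
case: (eqVneq x b) => [->|xb] /=; first by rewrite (negPf bA).
by case: (x \in val A).
Qed.

(** Park [k - j] tokens on a set [D] outside the copy and move only the other [j] tokens inside it;
    this embeds the small token graph in the large one. *)
Lemma copy_token_drawing (T : finType) (e : rel T) x0 (g : seq T) (a : rel nat)
    (j k : nat) :
  copy x0 e g a -> j <= k -> j <= size g -> k - j <= #|T| - size g ->
  parity_drawing (token_rel e k) -> parity_drawing (seq_token_rel a (size g) j).
Proof.
move=> [ug ge] jk jg kD.
have cardg : #|[set x in g]| = size g by rewrite cardsE; apply/card_uniqP.
have [D DC cardD] : exists2 D : {set T}, D \subset ~: [set x in g] & #|D| = k - j.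
  by apply: ex_subset_card; rewrite cardsCs setCK cardg.
pose F s := [set x in map (nth x0 g) s] :|: D.
have nthI : {in gtn (size g) &, injective (nth x0 g)}.
  by move=> i i' /= ? ? /eqP; rewrite nth_uniq // => /eqP.
have mapI s : all (gtn (size g)) s -> uniq s -> uniq (map (nth x0 g) s).
  by move=> /allP sg us; rewrite map_inj_in_uniq // => i i' /sg ? /sg ?; apply: nthI.
have memF s i : all (gtn (size g)) s -> i < size g -> (nth x0 g i \in F s) = (i \in s).
  move=> /allP sg ig; rewrite !inE.
  have -> : nth x0 g i \in D = false.
    apply: contraTF (mem_nth x0 ig) => /(subsetP DC).
    by rewrite !inE.
  by rewrite orbF; apply/mapP/idP=> [[i' i's /nthI->//]|is']; [apply: sg|exists i].
have cardF s : all (gtn (size g)) s -> uniq s -> size s = j -> #|F s| == k.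
  move=> sg us sj; rewrite cardsU cardD cardsE (card_uniqP (mapI _ sg us)) size_map sj.
  have -> : [set x in map (nth x0 g) s] :&: D = set0.
    apply/setP=> x; rewrite !inE; apply/negP=> /andP[/mapP[i is_ ->]] /(subsetP DC).
    by rewrite !inE mem_nth //; apply: (allP sg).
  by rewrite cards0 subn0 subnKC.
have ltn_uniq s : sorted ltn s -> uniq s := sorted_uniq ltn_trans ltnn (s := s).
have F0 : #|F (iota 0 j)| == k.
  apply: cardF; rewrite ?iota_uniq ?size_iota //.
  by apply/allP=> i; rewrite mem_iota /= => /leq_trans-> .
(* Sequences that are not configurations are sent to an arbitrary default; they are incident to no
   edge. *)
pose f s : token_vertex T k := insubd (exist _ (F (iota 0 j)) F0) (F s).
have fE s : all (gtn (size g)) s -> sorted ltn s -> size s = j -> val (f s) = F s.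
  by move=> sg /ltn_uniq us sj; rewrite val_insubd cardF.
have f_inj s t : all (gtn (size g)) s -> all (gtn (size g)) t -> sorted ltn s ->
    sorted ltn t -> size s = j -> size t = j -> s != t -> f s != f t.
  move=> sg tg ss st sj tj; apply: contra_neq => /(congr1 val); rewrite !fE // => E.
  apply: (irr_sorted_eq ltn_trans ltnn) => // i.
  case ig: (i < size g); first by rewrite -!memF // E.
  by apply/idP/idP=> [/(allP sg)|/(allP tg)] /=; rewrite ig.
have valid s t : seq_token_rel a (size g) j s t ->
    [/\ sorted ltn s, all (gtn (size g)) s, size s = j &
     [/\ sorted ltn t, all (gtn (size g)) t & size t = j]].
  move=> /and5P[ss st sg tg /andP[/eqP sj]] /hasP[i is_ /hasP[i' _ /and3P[_ _ pt]]].
  do 2 split=> //; rewrite (perm_size pt) /= size_rem // prednK // -has_predT.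
  by apply/hasP; exists i.
apply: (@parity_subdivision _ _ _ _ f (fun _ t => [:: f t])).
- move=> s t rst; have [ss sg sj [st tg tj]] := valid s t rst.
  have /and5P[_ _ _ _ /andP[_]] := rst.
  move=> /hasP[i is_ /hasP[i' i't /and3P[aii' i's pt]]].
  have [ig i'g] : i < size g /\ i' < size g by split; [apply: (allP sg)|apply: (allP tg)].
  rewrite /= andbT; split=> //.
  apply: (@token_rel_swap _ _ _ _ _ (nth x0 g i) (nth x0 g i')).
  + exact: ge.
  + by rewrite fE // memF.
  + by rewrite fE // memF.
  rewrite !fE //; apply/setP=> x; rewrite !inE.
  case xD: (x \in D).
    rewrite !orbT andbT; apply/esym/orP; right; apply: contraTneq xD => ->.
    by apply/negP=> /(subsetP DC); rewrite !inE mem_nth.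
  rewrite !orbF; apply/mapP/orP=> [[y]|].
    rewrite (perm_mem pt) inE (rem_filter _ (ltn_uniq _ ss)) mem_filter.
    case/orP=> [/eqP-> ->|/andP[/= yi ys] ->]; first by left.
    right; rewrite map_f // andbT nth_uniq //; exact: (allP sg).
  case=> [/eqP->|/andP[xi /mapP[y ys xy]]]; first by exists i'.
  exists y => //; rewrite (perm_mem pt) inE (rem_filter _ (ltn_uniq _ ss)) mem_filter ys /=.
  by rewrite andbT; apply/orP; right; apply: contraNneq xi => <-; rewrite xy.
move=> s t s' t' /valid[ss sg sj [st tg tj]] /valid[ss' sg' sj' [st' tg' tj']].
by move=> ? ? ? ? x y; rewrite !inE => /orP[]/eqP-> /orP[]/eqP->; apply: f_inj.
Qed.

(** * Unavoidable trees *)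

(* A tree grown from a single vertex: the i-th entry of [ps] is the index in [g]
   of the parent of the vertex of index i + 1. *)
Inductive tree_in (T : eqType) (e : rel T) : seq nat -> seq T -> Prop :=
| Tree_root x : tree_in e [::] [:: x]
| Tree_leaf ps g p y : tree_in e ps g -> p < size g -> y \notin g ->
    e (nth y g p) y -> tree_in e (rcons ps p) (rcons g y).

Definition tree_rel (ps : seq nat) : rel nat := fun i j =>
  ((0 < i <= size ps) && (nth 0 ps i.-1 == j)) ||
  ((0 < j <= size ps) && (nth 0 ps j.-1 == i)).

Lemma tree_in_size (T : eqType) (e : rel T) ps g :
  tree_in e ps g -> size g = (size ps).+1.
Proof. by elim=> //= {}ps {}g p y _ IH _ _ _; rewrite !size_rcons IH. Qed.

Lemma tree_in_parents (T : eqType) (e : rel T) ps g :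
  tree_in e ps g -> all (gtn (size g)) ps.
Proof.
elim=> //= {}ps {}g p y _ IH pg _ _; rewrite size_rcons all_rcons /= ltnW //=.
by apply: sub_all IH => i /= /ltnW.
Qed.

Lemma tree_in_copy (T : eqType) (e : rel T) x0 ps g :
  symmetric e -> tree_in e ps g -> copy x0 e g (tree_rel ps).
Proof.
move=> se; elim=> [x|{}ps {}g p y tg [ug ge] pg yg epy].
  by split=> // -[|i] [|j] //; rewrite /tree_rel /= ?andbF.
have sg := tree_in_size tg.
have parent i : 0 < i <= size (rcons ps p) ->
    e (nth x0 (rcons g y) i) (nth x0 (rcons g y) (nth 0 (rcons ps p) i.-1)).
  move=> /andP[i0]; rewrite size_rcons leq_eqVlt => /orP[/eqP->|lt_i] /=.
    by rewrite (nth_rcons 0) ltnn eqxx !nth_rcons pg sg ltnn eqxx se (set_nth_default y).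
  have lt_i' : i.-1 < size ps by rewrite prednK.
  have /= lt_p := allP (tree_in_parents tg) _ (mem_nth 0 lt_i').
  rewrite (nth_rcons 0) lt_i' !nth_rcons lt_p {1}sg lt_i.
  apply: ge => //; first by rewrite sg.
  by rewrite /tree_rel i0 -ltnS lt_i eqxx.
split=> [|i j _ _ /orP[]/andP[Hi /eqP <-]]; first by rewrite rcons_uniq yg.
  exact: parent.
by rewrite se; apply: parent.
Qed.

Definition adjacency (qs : seq nat) : seq (seq nat) :=
  let m := (size qs).+1 in
  [seq [seq w <- iota 0 m | tree_rel qs v w] | v <- iota 0 m].

(* Backtracking search for an extension of the partial embedding [q]; [if] rather
   than [&&] because call-by-value reduction computes both arguments of [&&]. *)
Fixpoint embeds_from (adj : seq (seq nat)) (ps q : seq nat) : bool :=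
  if ps is p :: ps' then
    has (fun w => if (p < size q) && (w \notin q)
                  then embeds_from adj ps' (rcons q w) else false)
        (nth [::] adj (nth 0 q p))
  else true.

Definition embeds (ps qs : seq nat) : bool :=
  let adj := adjacency qs in
  has (fun w => embeds_from adj ps [:: w]) (iota 0 (size qs).+1).

Lemma mem_adjacency qs v w : v < (size qs).+1 ->
  w \in nth [::] (adjacency qs) v -> tree_rel qs v w /\ w < (size qs).+1.
Proof.
move=> vm; rewrite (nth_map 0) ?size_iota // nth_iota // mem_filter mem_iota.
by case/andP=> vw /andP[_ wm].
Qed.

Lemma embeds_from_tree_in qs ps q ps0 : embeds_from (adjacency qs) ps q ->
  tree_in (tree_rel qs) ps0 q -> all (gtn (size qs).+1) q ->
  exists2 q', tree_in (tree_rel qs) (ps0 ++ ps) q' & all (gtn (size qs).+1) q'.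
Proof.
elim: ps q ps0 => [|p ps IH] q ps0; first by rewrite cats0; exists q.
move=> /hasP[w wadj /andP[/andP[pq wq] emb]] tq qm.
have [pw wm] := mem_adjacency (allP qm _ (mem_nth 0 pq)) wadj.
rewrite -cat_rcons; apply: IH emb _ _; last by rewrite all_rcons qm andbT.
by apply: Tree_leaf => //; rewrite (set_nth_default 0).
Qed.

Lemma tree_in_comp (T : eqType) (e : rel T) x0 g (a : rel nat) ps q :
  copy x0 e g a -> tree_in a ps q -> all (gtn (size g)) q ->
  tree_in e ps (map (nth x0 g) q).
Proof.
move=> [ug ge]; elim=> [x|{}ps {}q p y tq IH pq yq apy] /=.
  by move=> _; apply: Tree_root.
rewrite all_rcons map_rcons => /andP[/= yg qg]; apply: Tree_leaf; rewrite ?size_map //.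
- exact: IH.
- apply: contra yq => /mapP[i iq /eqP]; have ig := allP qg _ iq.
  by rewrite nth_uniq // => /eqP->.
- rewrite (set_nth_default x0) ?size_map // (nth_map y) //; apply: ge => //.
  by apply: (allP qg); apply: mem_nth.
Qed.

Lemma tree_in_uniq (T : eqType) (e : rel T) ps g : tree_in e ps g -> uniq g.
Proof. by elim=> //= *; rewrite rcons_uniq; apply/andP. Qed.

Lemma embeds_tree_in (T : eqType) (e : rel T) ps qs g :
  symmetric e -> embeds ps qs -> tree_in e qs g ->
  exists2 g', tree_in e ps g' & size g' <= size g.
Proof.
move=> se /hasP[w]; rewrite mem_iota /= => wm emb tg.
have x0 : T by case: (g) (tree_in_size tg) => [|x].
have [|q tq qm] := embeds_from_tree_in emb (Tree_root (tree_rel qs) w).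
  by rewrite /= wm.
rewrite -(tree_in_size tg) in qm.
exists (map (nth x0 g) q); first exact: tree_in_comp (tree_in_copy x0 se tg) tq qm.
rewrite size_map -[leqRHS](size_iota 0).
by apply: uniq_leq_size (tree_in_uniq tq) _ => i /(allP qm); rewrite mem_iota.
Qed.

(* The trees obtained by adding a leaf to a tree of [level], except those containing a
   tree of [bad] or another tree of the result. *)
Definition extensions (bad level : seq (seq nat)) : seq (seq nat) :=
  foldr (fun ps acc => if has (fun b => embeds b ps) (bad ++ acc) then acc else ps :: acc)
    [::] [seq rcons ps i | ps <- level, i <- iota 0 (size ps).+1].

(** Otherwise [g] would be closed under adjacency, against connectedness. *)
Lemma connected_extension (T : finType) (e : rel T) x0 (g : seq T) :
  symmetric e -> connected_graph e -> uniq g -> 0 < size g < #|T| ->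
  exists p y, [/\ p < size g, y \notin g & e (nth x0 g p) y].
Proof.
move=> se ce ug /andP[g0 gT].
case: (pickP [pred xy : T * T | [&& xy.1 \in g, xy.2 \notin g & e xy.1 xy.2]]).
  move=> [x y] /= /and3P[xg yg exy]; exists (index x g), y.
  by rewrite index_mem nth_index.
move=> noedge; have [y yg] : exists y, y \notin g.
  apply/existsP; apply: contraTT gT; rewrite negb_exists -leqNgt => /forallP allg.
  rewrite -(card_uniqP ug); apply/subset_leq_card/subsetP => z _.
  by have := allg z; rewrite negbK.
have cl : closed e (mem g).
  apply: (intro_closed (sym_connect_sym se)) => x z exz xg.
  apply: contraFT (noedge (x, z)) => zg.
  by rewrite /= xg zg.
have := closed_connect cl (ce (nth x0 g 0) y).
by rewrite /= mem_nth // => /esym; rewrite (negPf yg).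
Qed.

(** A discarded extension contains a tree that is bad or kept, which takes its place. The
    replacement may have fewer vertices, hence the inequality on sizes. *)
Lemma extensions_tree_in (T : finType) (e : rel T) bad level ps g :
  symmetric e -> connected_graph e -> ps \in level -> tree_in e ps g -> size g < #|T| ->
  exists qs g', [/\ qs \in bad ++ extensions bad level, tree_in e qs g' &
                    size g' <= (size g).+1].
Proof.
move=> se ce psl tg gT; have sg := tree_in_size tg.
have x0 : T by case: (g) sg => [|x].
have [|p [y [pg yg epy]]] := connected_extension x0 se ce (tree_in_uniq tg).
  by rewrite gT sg.
have tg' : tree_in e (rcons ps p) (rcons g y).
  by apply: Tree_leaf => //; rewrite (set_nth_default x0).
rewrite -(size_rcons g y); move: (rcons g y) tg' => g' tg'.
have : rcons ps p \in [seq rcons ps i | ps <- level, i <- iota 0 (size ps).+1].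
  by apply/allpairsPdep; exists ps, p; rewrite mem_iota -sg.
rewrite /extensions; elim: [seq _ | _ <- _, _ <- _] => [//|t L IH].
rewrite inE /= => /orP[/eqP <-|/IH[qs [g1 [qsb tg1 sg1]]]]; last first.
  exists qs, g1; split=> //; case: ifP => // _; move: qsb.
  by rewrite !mem_cat inE => /orP[]->; rewrite ?orbT.
case: ifP => [/hasP[b bb emb]|_]; last first.
  by exists (rcons ps p), g'; rewrite mem_cat inE eqxx orbT.
by have [g1 tg1 sg1] := embeds_tree_in se emb tg'; exists b, g1.
Qed.

(** Each round uses at most one more vertex of the graph and ends in a bad tree or in the next
    level. The last level is empty, so a bad tree occurs on the way. *)
Lemma unavoidable_tree_in (T : finType) (e : rel T) bad fuel level ps g :
  symmetric e -> connected_graph e -> iter fuel (extensions bad) level = [::] ->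
  ps \in level -> tree_in e ps g -> size g + fuel <= #|T| ->
  exists b g', b \in bad /\ tree_in e b g'.
Proof.
move=> se ce; elim: fuel level ps g => [|fuel IH] level ps g; first by move=> /= ->.
rewrite iterSr => /IH{}IH psl tg le_gT.
have [|qs [g' [qsb tg' sg']]] := extensions_tree_in bad se ce psl tg.
  by rewrite (leq_trans _ le_gT) // addnS ltnS leq_addr.
move: qsb; rewrite mem_cat => /orP[qsb|/IH/(_ tg')]; first by exists qs, g'.
apply; apply: leq_trans le_gT; rewrite addnS -addSn leq_add2r //.
Qed.

(** * Certificates for the 6-cycle and for small trees *)

Definition cycle6_certificate : seq (seq (seq nat)) :=
  [:: [:: [:: 2; 5]; [:: 3; 5]]; [:: [:: 2; 5]; [:: 1; 5]; [:: 1; 4]];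
      [:: [:: 2; 5]; [:: 0; 2]]; [:: [:: 0; 3]; [:: 3; 5]];
      [:: [:: 0; 3]; [:: 0; 4]; [:: 1; 4]]; [:: [:: 0; 3]; [:: 0; 2]];
      [:: [:: 2; 4]; [:: 3; 4]; [:: 3; 5]]; [:: [:: 2; 4]; [:: 1; 4]];
      [:: [:: 2; 4]; [:: 2; 3]; [:: 1; 3]; [:: 1; 2]; [:: 0; 2]]].

(** Each parent list carries nine walks, whose entries are token positions. The trees are the star
    with four leaves and one edge subdivided; the star with six leaves; a claw with two leaves added
    at one end and one at another; two vertices of degree 3 at distance 2; and a claw with one leg
    of length 4. *)
Definition two_token_trees : seq (seq nat * seq (seq (seq nat))) := [::
  ([:: 0; 0; 0; 0; 1],
   [:: [:: [:: 1; 4]; [:: 4; 5]; [:: 0; 5]]; [:: [:: 1; 4]; [:: 0; 1]];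
       [:: [:: 1; 4]; [:: 0; 4]; [:: 2; 4]; [:: 0; 2]];
       [:: [:: 1; 3]; [:: 3; 5]; [:: 0; 5]]; [:: [:: 1; 3]; [:: 0; 1]];
       [:: [:: 1; 3]; [:: 0; 3]; [:: 2; 3]; [:: 0; 2]];
       [:: [:: 1; 2]; [:: 2; 5]; [:: 0; 5]]; [:: [:: 1; 2]; [:: 0; 1]];
       [:: [:: 1; 2]; [:: 0; 2]]]);
  ([:: 0; 0; 0; 0; 0; 0],
   [:: [:: [:: 0; 3]; [:: 2; 3]; [:: 0; 2]]; [:: [:: 0; 3]; [:: 1; 3]; [:: 0; 1]];
       [:: [:: 0; 3]; [:: 3; 5]; [:: 0; 5]]; [:: [:: 0; 4]; [:: 2; 4]; [:: 0; 2]];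
       [:: [:: 0; 4]; [:: 1; 4]; [:: 0; 1]]; [:: [:: 0; 4]; [:: 4; 5]; [:: 0; 5]];
       [:: [:: 0; 6]; [:: 2; 6]; [:: 0; 2]]; [:: [:: 0; 6]; [:: 1; 6]; [:: 0; 1]];
       [:: [:: 0; 6]; [:: 5; 6]; [:: 0; 5]]]);
  ([:: 0; 0; 0; 1; 1; 2],
   [:: [:: [:: 0; 1]; [:: 0; 4]; [:: 2; 4]];
       [:: [:: 0; 1]; [:: 1; 3]; [:: 0; 3]; [:: 2; 3]; [:: 0; 2]];
       [:: [:: 0; 1]; [:: 0; 5]; [:: 2; 5]]; [:: [:: 1; 2]; [:: 2; 4]];
       [:: [:: 1; 2]; [:: 0; 2]]; [:: [:: 1; 2]; [:: 2; 5]];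
       [:: [:: 1; 6]; [:: 4; 6]; [:: 2; 4]]; [:: [:: 1; 6]; [:: 0; 6]; [:: 0; 2]];
       [:: [:: 1; 6]; [:: 5; 6]; [:: 2; 5]]]);
  ([:: 0; 0; 0; 1; 4; 4],
   [:: [:: [:: 3; 4]; [:: 3; 6]; [:: 0; 6]]; [:: [:: 3; 4]; [:: 0; 4]];
       [:: [:: 3; 4]; [:: 3; 5]; [:: 0; 5]]; [:: [:: 1; 4]; [:: 1; 6]; [:: 0; 6]];
       [:: [:: 1; 4]; [:: 0; 4]]; [:: [:: 1; 4]; [:: 1; 5]; [:: 0; 5]];
       [:: [:: 2; 4]; [:: 2; 6]; [:: 0; 6]]; [:: [:: 2; 4]; [:: 0; 4]];
       [:: [:: 2; 4]; [:: 2; 5]; [:: 0; 5]]]);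
  ([:: 0; 0; 0; 1; 4; 5],
   [:: [:: [:: 0; 6]; [:: 3; 6]; [:: 3; 5]]; [:: [:: 0; 6]; [:: 1; 6]; [:: 1; 5]];
       [:: [:: 0; 6]; [:: 2; 6]; [:: 2; 5]]; [:: [:: 0; 4]; [:: 3; 4]; [:: 3; 5]];
       [:: [:: 0; 4]; [:: 1; 4]; [:: 1; 5]]; [:: [:: 0; 4]; [:: 2; 4]; [:: 2; 5]];
       [:: [:: 0; 5]; [:: 3; 5]]; [:: [:: 0; 5]; [:: 1; 5]]; [:: [:: 0; 5]; [:: 2; 5]]])].

(** The last tree is the path on 7 vertices: with three tokens even long paths are excluded. *)
Definition three_token_trees : seq (seq nat * seq (seq (seq nat))) := [::
  ([:: 0; 0; 0; 0; 0],
   [:: [:: [:: 0; 1; 4]; [:: 1; 2; 4]; [:: 0; 1; 2]; [:: 1; 2; 5]];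
       [:: [:: 0; 1; 4]; [:: 1; 3; 4]; [:: 0; 3; 4]; [:: 3; 4; 5]];
       [:: [:: 0; 1; 4]; [:: 1; 4; 5]]; [:: [:: 0; 1; 5]; [:: 1; 2; 5]];
       [:: [:: 0; 1; 5]; [:: 1; 3; 5]; [:: 0; 3; 5]; [:: 3; 4; 5]];
       [:: [:: 0; 1; 5]; [:: 1; 4; 5]];
       [:: [:: 0; 4; 5]; [:: 2; 4; 5]; [:: 0; 2; 5]; [:: 1; 2; 5]];
       [:: [:: 0; 4; 5]; [:: 3; 4; 5]]; [:: [:: 0; 4; 5]; [:: 1; 4; 5]]]);
  ([:: 0; 0; 0; 1; 2],
   [:: [:: [:: 0; 3; 5]; [:: 0; 2; 3]; [:: 1; 2; 3]];
       [:: [:: 0; 3; 5]; [:: 2; 3; 5]; [:: 0; 2; 5]; [:: 1; 2; 5]; [:: 2; 4; 5]; [:: 0; 4; 5]];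
       [:: [:: 0; 3; 5]; [:: 1; 3; 5]]; [:: [:: 3; 4; 5]; [:: 2; 3; 4]; [:: 1; 2; 3]];
       [:: [:: 3; 4; 5]; [:: 0; 4; 5]]; [:: [:: 3; 4; 5]; [:: 1; 3; 5]];
       [:: [:: 0; 1; 5]; [:: 0; 1; 2]; [:: 1; 2; 3]]; [:: [:: 0; 1; 5]; [:: 0; 4; 5]];
       [:: [:: 0; 1; 5]; [:: 1; 3; 5]]]);
  ([:: 0; 0; 0; 0; 1; 1],
   [:: [:: [:: 1; 2; 5]; [:: 0; 2; 5]; [:: 2; 3; 5]; [:: 0; 3; 5]];
       [:: [:: 1; 2; 5]; [:: 2; 5; 6]; [:: 0; 5; 6]]; [:: [:: 1; 2; 5]; [:: 0; 1; 5]];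
       [:: [:: 1; 4; 5]; [:: 0; 4; 5]; [:: 3; 4; 5]; [:: 0; 3; 5]];
       [:: [:: 1; 4; 5]; [:: 4; 5; 6]; [:: 0; 5; 6]]; [:: [:: 1; 4; 5]; [:: 0; 1; 5]];
       [:: [:: 1; 3; 5]; [:: 0; 3; 5]]; [:: [:: 1; 3; 5]; [:: 3; 5; 6]; [:: 0; 5; 6]];
       [:: [:: 1; 3; 5]; [:: 0; 1; 5]]]);
  ([:: 0; 0; 0; 0; 1; 5],
   [:: [:: [:: 0; 5; 6]; [:: 4; 5; 6]; [:: 1; 4; 6]];
       [:: [:: 0; 5; 6]; [:: 2; 5; 6]; [:: 1; 2; 6]];
       [:: [:: 0; 5; 6]; [:: 3; 5; 6]; [:: 1; 3; 6]]; [:: [:: 0; 4; 6]; [:: 1; 4; 6]];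
       [:: [:: 0; 4; 6]; [:: 2; 4; 6]; [:: 0; 2; 6]; [:: 1; 2; 6]];
       [:: [:: 0; 4; 6]; [:: 3; 4; 6]; [:: 0; 3; 6]; [:: 1; 3; 6]];
       [:: [:: 0; 1; 6]; [:: 1; 4; 6]]; [:: [:: 0; 1; 6]; [:: 1; 2; 6]];
       [:: [:: 0; 1; 6]; [:: 1; 3; 6]]]);
  ([:: 0; 0; 0; 1; 4; 4],
   [:: [:: [:: 0; 4; 5]; [:: 0; 5; 6]; [:: 0; 4; 6]; [:: 0; 1; 6]; [:: 0; 1; 4]];
       [:: [:: 0; 4; 5]; [:: 3; 4; 5]; [:: 1; 3; 5]];
       [:: [:: 0; 4; 5]; [:: 2; 4; 5]; [:: 1; 2; 5]]; [:: [:: 0; 1; 5]; [:: 0; 1; 4]];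
       [:: [:: 0; 1; 5]; [:: 1; 3; 5]]; [:: [:: 0; 1; 5]; [:: 1; 2; 5]];
       [:: [:: 0; 3; 5]; [:: 0; 3; 4]; [:: 1; 3; 4]; [:: 0; 1; 4]];
       [:: [:: 0; 3; 5]; [:: 1; 3; 5]];
       [:: [:: 0; 3; 5]; [:: 2; 3; 5]; [:: 0; 2; 5]; [:: 1; 2; 5]]]);
  ([:: 0; 0; 0; 1; 4; 5],
   [:: [:: [:: 0; 1; 4]; [:: 1; 2; 4]; [:: 1; 2; 5]];
       [:: [:: 0; 1; 4]; [:: 1; 3; 4]; [:: 1; 3; 5]]; [:: [:: 0; 1; 4]; [:: 0; 1; 5]];
       [:: [:: 0; 4; 5]; [:: 2; 4; 5]; [:: 1; 2; 5]];
       [:: [:: 0; 4; 5]; [:: 3; 4; 5]; [:: 1; 3; 5]]; [:: [:: 0; 4; 5]; [:: 0; 1; 5]];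
       [:: [:: 0; 1; 6]; [:: 1; 2; 6]; [:: 1; 2; 5]];
       [:: [:: 0; 1; 6]; [:: 1; 3; 6]; [:: 1; 3; 5]]; [:: [:: 0; 1; 6]; [:: 0; 1; 5]]]);
  ([:: 0; 0; 1; 2; 3; 4],
   [:: [:: [:: 0; 3; 6]; [:: 2; 3; 6]]; [:: [:: 0; 3; 6]; [:: 0; 1; 6]; [:: 1; 2; 6]];
       [:: [:: 0; 3; 6]; [:: 0; 5; 6]]; [:: [:: 2; 3; 4]; [:: 2; 3; 6]];
       [:: [:: 2; 3; 4]; [:: 1; 2; 4]; [:: 1; 2; 6]];
       [:: [:: 2; 3; 4]; [:: 0; 3; 4]; [:: 0; 4; 5]; [:: 0; 5; 6]];
       [:: [:: 3; 4; 6]; [:: 2; 3; 6]]; [:: [:: 3; 4; 6]; [:: 1; 4; 6]; [:: 1; 2; 6]];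
       [:: [:: 3; 4; 6]; [:: 4; 5; 6]; [:: 2; 5; 6]; [:: 0; 5; 6]]])].

Definition tree_certified (j : nat) (pw : seq nat * seq (seq (seq nat))) : bool :=
  (j <= (size pw.1).+1) &&
  K33_certificate [::] (seq_token_rel (tree_rel pw.1) (size pw.1).+1 j) pw.2.

Lemma two_token_trees_certified : all (tree_certified 2) two_token_trees.
Proof. by vm_compute. Qed.

Lemma three_token_trees_certified : all (tree_certified 3) three_token_trees.
Proof. by vm_compute. Qed.

(** Seven leaves added to the 4 vertices of a claw make 11 vertices; here [10 < #|T|] is used in
    full. *)
Lemma two_token_trees_unavoidable :
  iter 7 (extensions (map fst two_token_trees)) [:: [:: 0; 0; 0]] = [::].
Proof. by vm_compute. Qed.

Lemma three_token_trees_unavoidable :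
  iter 6 (extensions (map fst three_token_trees)) [:: [::]] = [::].
Proof. by vm_compute. Qed.

Lemma certified_tree_nonplanar (T : finType) (e : rel T) (bad : seq _) j k ps g :
  symmetric e -> all (tree_certified j) bad -> ps \in map fst bad -> tree_in e ps g ->
  j <= k -> k - j <= #|T| - size g -> ~ planar (token_rel e k).
Proof.
move=> se /allP cert /mapP[[ps' w] /cert/andP[/= jps Kw] ->] tg jk kT.
have x0 : T by case: (g) (tree_in_size tg) => [|x].
move=> /planar_parity_drawing/(copy_token_drawing (tree_in_copy x0 se tg) jk).
rewrite (tree_in_size tg) => /(_ jps); rewrite -{1}(tree_in_size tg) => /(_ kT).
exact: K33_certificate_no_drawing Kw.
Qed.

(** * Cycles *)

Definition cycle_rel (n : nat) : rel nat := fun i j =>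
  [|| i.+1 == j, j.+1 == i, (i == 0) && (j.+1 == n) | (j == 0) && (i.+1 == n)].

Definition pair_seq (x i : nat) : seq nat := [:: minn x i; maxn x i].

Lemma mem_pair_seq x i : pair_seq x i =i [:: x; i].
Proof.
move=> y; rewrite /pair_seq /minn /maxn !inE.
by case: (x < i) => //; rewrite orbC.
Qed.

Lemma sorted_pair_seq x i : x != i -> sorted ltn (pair_seq x i).
Proof.
move=> xi; rewrite /pair_seq /minn /maxn; case: ifP => [lt|/negbT]; first by rewrite /= lt.
by rewrite -leqNgt leq_eqVlt eq_sym (negPf xi) /= => ->.
Qed.

Lemma eq_pair_seq s x i : sorted ltn s -> x != i -> s =i [:: x; i] -> s = pair_seq x i.
Proof.
move=> ss xi sE; apply: (irr_sorted_eq ltn_trans ltnn ss (sorted_pair_seq xi)) => y.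
by rewrite sE mem_pair_seq.
Qed.

(** [x] is the token at rest while the other one moves from [i] to [j]. *)
Lemma seq_token_rel2P (a : rel nat) m s t :
  reflect (exists x i j, [/\ s = pair_seq x i, t = pair_seq x j &
             [/\ x < m, i < m & j < m] /\ [/\ x != i, x != j, i != j & a i j]])
          (seq_token_rel a m 2 s t).
Proof.
apply: (iffP idP) => [|[x [i [j [-> ->]]]]].
  move=> /and5P[ss st sm tm /andP[/eqP s2]] /hasP[i is_ /hasP[j jt /and3P[aij js pt]]].
  have us := sorted_uniq ltn_trans ltnn ss.
  have [x rE] : exists x, rem i s = [:: x].
    by move: (size_rem is_); rewrite s2; case: (rem i s) => [|x [|]] //; exists x.
  have xs : x \in s by apply: (mem_rem (x := i)); rewrite rE inE.
  have xi : x != i.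
    by have := mem_rem_uniq i us x; rewrite rE !inE eqxx => /esym/andP[].
  have ps := perm_to_rem is_; rewrite rE in ps pt.
  exists x, i, j; split.
  - by apply: eq_pair_seq => // y; rewrite (perm_mem ps) !inE orbC.
  - apply: eq_pair_seq => //; first by apply: contraNneq js => <-.
    by move=> y; rewrite (perm_mem pt) !inE orbC.
  split; first by split; [apply: (allP sm)|apply: (allP sm)|apply: (allP tm)].
  by split=> //; [apply: contraNneq js => <-|apply: contraNneq js => <-].
move=> [[xm im jm] [xi xj ij aij]]; apply/and5P; split; try exact: sorted_pair_seq.
- by apply/allP=> y; rewrite mem_pair_seq !inE => /orP[]/eqP->.
- by apply/allP=> y; rewrite mem_pair_seq !inE => /orP[]/eqP->.
rewrite [_ == _]eqxx andTb.
apply/hasP; exists i; first by rewrite mem_pair_seq !inE eqxx orbT.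
apply/hasP; exists j; first by rewrite mem_pair_seq !inE eqxx orbT.
rewrite aij mem_pair_seq !inE (eq_sym j) (negPf xj) (eq_sym j) (negPf ij) !andTb.
have uniq_pair k : x != k -> uniq (pair_seq x k).
  by move=> xk; apply: sorted_uniq ltn_trans ltnn _ (sorted_pair_seq xk).
apply: uniq_perm; first exact: uniq_pair.
  rewrite cons_uniq (rem_uniq i (uniq_pair i xi)) andbT mem_rem_uniq ?uniq_pair // inE.
  by rewrite /= mem_pair_seq !inE (eq_sym j x) (negPf xj) (eq_sym j) (negPf ij) andbF.
move=> y; rewrite mem_pair_seq [RHS]in_cons mem_rem_uniq ?uniq_pair // [in RHS]inE /=.
rewrite mem_pair_seq !inE orbC; congr (_ || _).
by case: (eqVneq y i) => [->|] /=; rewrite ?orbF // eq_sym (negPf xi).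
Qed.

Lemma pair_seq_inj x i j : pair_seq x i = pair_seq x j -> i = j.
Proof.
move=> E; have := mem_pair_seq x i; rewrite E => {}E.
have := E i; have := E j; rewrite !mem_pair_seq !inE !eqxx !orbT.
move=> /esym/orP[/eqP->|/eqP->//] /orP[/eqP->//|/eqP//].
Qed.

(* The new vertex n subdivides the edge between n - 1 and 0 of the shorter cycle, so a
   move along this edge while the other token is at x becomes a walk through {x, n}. *)
Lemma cycle_drawing_shrink n : 3 <= n ->
  parity_drawing (seq_token_rel (cycle_rel n.+1) n.+1 2) ->
  parity_drawing (seq_token_rel (cycle_rel n) n 2).
Proof.
move=> n3.
pose common (s t : seq nat) := head 0 [seq x <- s | x \in t].
have commonE x i j : x != i -> i != j -> common (pair_seq x i) (pair_seq x j) = x.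
  move=> xi ij; rewrite /common /pair_seq /minn /maxn.
  by case: (x < i); rewrite /= !mem_pair_seq !inE eqxx (negPf ij) (eq_sym i) (negPf xi).
pose big := seq_token_rel (cycle_rel n.+1) n.+1 2.
pose route s t := if big s t then [:: t] else [:: pair_seq (common s t) n; t].
have routeE s t : seq_token_rel (cycle_rel n) n 2 s t ->
   route s t = [:: t] \/
   exists x i j, [/\ s = pair_seq x i, t = pair_seq x j, route s t = [:: pair_seq x n; t],
    [/\ x != i, x != j & x < n] & (i = 0 /\ j = n.-1) \/ (i = n.-1 /\ j = 0)].
  move=> /seq_token_rel2P[x [i [j [sE tE [[xn i_n jn] [xi xj ij aij]]]]]].
  rewrite /route; case: ifP => nbig; [by left|right]; exists x, i, j.
  rewrite sE tE commonE //; split=> //.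
  case/or4P: aij.
  - move=> ijS; case/negP: nbig; apply/seq_token_rel2P; exists x, i, j; split=> //.
    by split; split; rewrite ?leqW // /cycle_rel ijS.
  - move=> ijS; case/negP: nbig; apply/seq_token_rel2P; exists x, i, j; split=> //.
    by split; split; rewrite ?leqW // /cycle_rel ijS orbT.
  - by move=> /andP[/eqP-> /eqP<-]; left.
  - by move=> /andP[/eqP-> /eqP<-]; right.
move=> drawing; apply: (@parity_subdivision _ _ _ _ (fun s => s) route) drawing.
- move=> s t st; split; last by rewrite /route; case: ifP.
  have [rE|[x [i [j [sE tE rE [xi xj xn] ij]]]]] := routeE s t st.
    by rewrite rE /= andbT; move: rE; rewrite /route -/(big s t); case: ifP.
  rewrite rE /= andbT sE tE; have xn' : x != n by rewrite neq_ltn xn.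
  have n0 : 0 < n by apply: leq_trans n3.
  have nn : n.-1 != n by rewrite neq_ltn prednK // leqnn.
  have n0' : 0 != n by rewrite neq_ltn n0.
  have xn1 : x < n.+1 := leqW xn.
  apply/andP; split; apply/seq_token_rel2P.
    exists x, i, n; split=> //; case: ij => -[iE jE]; rewrite iE jE in xi xj *.
      by split; split; rewrite // /cycle_rel !eqxx !orbT.
    by split; split; rewrite // ?ltnS ?leq_pred // /cycle_rel prednK // eqxx.
  exists x, n, j; split=> //; case: ij => -[iE jE]; rewrite iE jE in xi xj *.
    split; split; rewrite // ?ltnS ?leq_pred // 1?eq_sym //.
    by rewrite /cycle_rel prednK // eqxx orbT.
  by split; split; rewrite // 1?eq_sym // /cycle_rel !eqxx !orbT.
have edge s t : seq_token_rel (cycle_rel n) n 2 s t -> n \notin s /\ n \notin t.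
  move=> /and5P[_ _ /allP sn /allP tn _].
  by split; [apply/negP=> /sn|apply/negP=> /tn]; rewrite /= ltnn.
have walkE s t y : seq_token_rel (cycle_rel n) n 2 s t -> y \in s :: route s t ->
    [\/ y = s, y = t | exists2 x, y = pair_seq x n &
       (s = pair_seq x 0 /\ t = pair_seq x n.-1) \/
       (s = pair_seq x n.-1 /\ t = pair_seq x 0)].
  move=> st; have [->|[x [i [j [sE tE -> _ ij]]]]] := routeE s t st; rewrite !inE.
    by case/orP=> /eqP->; [constructor 1|constructor 2].
  case/or3P=> /eqP->; [by constructor 1|constructor 3|by constructor 2].
  by exists x; rewrite // sE tE; case: ij => -[-> ->]; [left|right].
have n_pair x : n \in pair_seq x n by rewrite mem_pair_seq !inE eqxx orbT.
move=> s t s' t' st st' ss' st'' ts' tt' y z /(walkE _ _ _ st) yE /(walkE _ _ _ st') zE.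
have [ns nt] := edge _ _ st; have [ns' nt'] := edge _ _ st'.
case: yE => [->|->|[x yE sE]]; case: zE => [->|->|[x' zE sE']] //.
- by apply: contraNneq ns => ->; rewrite zE.
- by apply: contraNneq nt => ->; rewrite zE.
- by apply: contraNneq ns' => <-; rewrite yE.
- by apply: contraNneq nt' => <-; rewrite yE.
(* A common inserted vertex {x, n} determines x, hence the ends {x, 0} and {x, n - 1} of both walks,
   which would then share an end. *)
apply/eqP; rewrite yE zE /pair_seq minnC maxnC (minnC x') (maxnC x') => /pair_seq_inj xx'.
rewrite -xx' in sE'.
by move: ss' st''; case: sE sE' => -[-> _] [] [-> ->]; rewrite eqxx ?andbF.
Qed.

Lemma cycle_no_drawing n : 6 <= n ->
  ~ parity_drawing (seq_token_rel (cycle_rel n) n 2).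
Proof.
elim: n => // n IH; rewrite leq_eqVlt => /orP[/eqP<-|n6].
  by apply: (@K33_certificate_no_drawing _ [::] _ cycle6_certificate); vm_compute.
rewrite ltnS in n6; have n3 : 3 <= n by apply: leq_trans n6.
by move=> /(cycle_drawing_shrink n3)/(IH n6).
Qed.

(** * Planar drawings *)

Lemma planar_inj (W V : finType) (r' : rel W) (r : rel V) (f : W -> V) :
  injective f -> (forall x y, r' x y -> r (f x) (f y)) -> planar r -> planar r'.
Proof.
move=> f_inj fr [p [c [p_inj curve]]].
exists (p \o f), (fun x y => c (f x) (f y)); split=> [|x y /fr /curve].
  exact: inj_comp.
move=> [c1 [c2 [c_0 [c_1 [cI [cV cE]]]]]]; do 5 (split=> //).
split=> [z|u v s t /fr ruv s01 t01 /(cE _ _ _ _ ruv s01 t01)]; first exact: cV.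
by case=> -[/f_inj-> /f_inj->]; [left|right].
Qed.

(** Complementation preserves symmetric differences, hence adjacency of token configurations. *)
Lemma planar_token_compl (T : finType) (e : rel T) k :
  planar (token_rel e (#|T| - k)) -> planar (token_rel e k).
Proof.
have cardC (A : token_vertex T k) : #|~: val A| == #|T| - k.
  by rewrite cardsCs setCK (eqP (valP A)).
pose f A : token_vertex T (#|T| - k) := exist _ (~: val A) (cardC A).
move=> pl; apply: (@planar_inj _ _ _ _ f) pl => [A B|A B].
  by move=> /(congr1 val)/= /setC_inj/val_inj.
move=> /existsP[a /existsP[b /andP[eab AB]]]; apply/existsP; exists a.
apply/existsP; exists b; rewrite eab /= -(eqP AB); apply/eqP/setP=> x.
by rewrite !inE; case: (x \in val A); case: (x \in val B).
Qed.

Definition grid_adj (p q : nat * nat) : bool :=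
  [|| q == (p.1.+1, p.2), q == (p.1, p.2.+1), p == (q.1.+1, q.2) | p == (q.1, q.2.+1)].

Local Open Scope R_scope.

Definition grid_embed (p : nat * nat) : R * R := (INR p.1, INR p.2).

Definition segment (p q : nat * nat) (t : R) : R * R :=
  (INR p.1 + t * (INR q.1 - INR p.1), INR p.2 + t * (INR q.2 - INR p.2)).

Definition unit_step (horizontal : bool) (p : nat * nat) : nat * nat :=
  if horizontal then (p.1.+1, p.2) else (p.1, p.2.+1).

Definition unit_point (horizontal : bool) (p : nat * nat) (s : R) : R * R :=
  if horizontal then (INR p.1 + s, INR p.2) else (INR p.1, INR p.2 + s).

(** Both orientations of an edge are reduced to one parametrisation, starting at the lower or left
    end and run backwards if necessary. *)
Lemma grid_segment p q : grid_adj p q -> exists h p0,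
  (p = p0 /\ q = unit_step h p0 /\ forall t, segment p q t = unit_point h p0 t) \/
  (q = p0 /\ p = unit_step h p0 /\ forall t, segment p q t = unit_point h p0 (1 - t)).
Proof.
case: p q => [a b] [c d] /or4P[]/eqP[-> ->]; [exists true, (a, b)|exists false, (a, b)|
  exists true, (c, d)|exists false, (c, d)];
  [left|left|right|right]; do 2 split=> //;
  move=> t; rewrite /segment /unit_point /fst /snd S_INR; congr pair; lra.
Qed.

Lemma INR_between a b : INR a < INR b < INR a + 1 -> False.
Proof.
rewrite -S_INR => -[/INR_lt/ltP ab /INR_lt/ltP ba].
by rewrite ltnS leqNgt ab in ba.
Qed.

Lemma INR_close a b : INR a < INR b + 1 -> INR b < INR a + 1 -> a = b.
Proof.
rewrite -!S_INR => /INR_lt/ltP ab /INR_lt/ltP ba.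
by apply/eqP; rewrite eqn_leq; apply/andP; rewrite !ltnS in ab ba.
Qed.

Lemma unit_point_vertex h p s q : 0 < s < 1 -> unit_point h p s <> grid_embed q.
Proof.
move=> s01; case: h => -[] E1 E2.
  by apply: (@INR_between p.1 q.1); lra.
by apply: (@INR_between p.2 q.2); lra.
Qed.

(** An interior point of a unit edge has exactly one non-integral coordinate. It gives the
    direction, and integer parts give the lower or left end. *)
Lemma unit_point_inj h p s h' p' s' : 0 < s < 1 -> 0 < s' < 1 ->
  unit_point h p s = unit_point h' p' s' -> h = h' /\ p = p'.
Proof.
case: p p' => [a b] [a' b'] s01 s01'; case: h; case: h' => -[/= E1 E2].
- by split=> //; congr pair; apply: INR_close; lra.
- by case: (@INR_between a a'); lra.
- by case: (@INR_between a' a); lra.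
- by split=> //; congr pair; apply: INR_close; lra.
Qed.

Lemma continuity_affine a b : continuity (fun t => a + t * b).
Proof.
apply: continuity_plus; first by apply: continuity_const.
apply: continuity_mult; last by apply: continuity_const.
exact: derivable_continuous derivable_id.
Qed.

Lemma grid_planar (V : finType) (r : rel V) (q : V -> nat * nat) :
  injective q -> (forall x y, r x y -> grid_adj (q x) (q y)) -> planar r.
Proof.
move=> q_inj rq; exists (fun x => grid_embed (q x)), (fun x y => segment (q x) (q y)).
split=> [x y [/INR_eq E1 /INR_eq E2]|x y rxy].
  by apply: q_inj; rewrite (surjective_pairing (q x)) E1 E2 -surjective_pairing.
have [h [p0 pE]] := grid_segment (rq _ _ rxy).
do 2 (split; first exact: continuity_affine).
split; first by rewrite /segment /grid_embed; congr pair; lra.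
split; first by rewrite /segment /grid_embed; congr pair; lra.
have flip t : 0 < t < 1 -> 0 < 1 - t < 1 by lra.
split.
  move=> s t _ _; case: pE => -[_ [_ E]]; rewrite !E; case: h {E} => -[] /=; lra.
split.
  move=> z t t01; case: pE => -[_ [_ ->]]; first exact: unit_point_vertex.
  by apply: unit_point_vertex; apply: flip.
move=> u v s t /rq/grid_segment[h' [p0' pE']] s01 t01.
have s01' := flip _ s01; have t01' := flip _ t01.
case: pE => -[qx [qy ->]]; case: pE' => -[qu [qv ->]] /unit_point_inj[] // Eh Ep;
  rewrite -{}Eh -{}Ep in qu qv; [left|right|right|left];
  by split; apply: q_inj; rewrite ?qx ?qy.
Qed.

Local Close Scope R_scope.

(** The two one-sided differences are disjoint, have equal size and together form a nonempty set of
    at most two elements. So both are singletons, and one token is common. *)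
Lemma token_rel2P (T : finType) (e : rel T) (A B : token_vertex T 2) :
  symmetric e -> token_rel e 2 A B ->
  exists x a b, [/\ val A = [set x; a], val B = [set x; b], x != a, x != b & e a b].
Proof.
move=> se /existsP[a0 /existsP[b0 /andP[eab /eqP AB]]].
have cA := eqP (valP A); have cB := eqP (valP B).
have cAB : #|val A :\: val B| = #|val B :\: val A|.
  by apply/eqP; rewrite -(eqn_add2l #|val A :&: val B|) cardsID setIC cardsID cA cB.
have dis : (val A :\: val B) :&: (val B :\: val A) = set0.
  by apply/setP=> x; rewrite !inE; case: (x \in val A); rewrite ?andbF.
have le1 : #|val A :\: val B| <= 1.
  have := cards2 a0 b0; rewrite -AB cardsU dis cards0 subn0 -cAB addnn.
  by case: (#|_|) => [|[|n]] // H; have := leq_b1 (a0 != b0); rewrite -ltnS -H.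
have memab x : (x \in val A :\: val B) || (x \in val B :\: val A) = (x == a0) || (x == b0).
  by have := congr1 (fun S : {set T} => x \in S) AB; rewrite !inE.
have [a aA] : exists a, a \in val A :\: val B.
  apply/set0Pn; rewrite -card_gt0 lt0n; apply/eqP=> c0; have := memab a0.
  by rewrite (cards0_eq c0) (cards0_eq (etrans (esym cAB) c0)) inE eqxx.
have [b bB] : exists b, b \in val B :\: val A.
  by apply/set0Pn; rewrite -card_gt0 -cAB card_gt0; apply/set0Pn; exists a.
have AE : val A :\: val B = [set a].
  by apply/eqP; rewrite eq_sym eqEcard sub1set aA cards1.
have BE : val B :\: val A = [set b].
  by apply/eqP; rewrite eq_sym eqEcard sub1set bB cards1 -cAB.
have [x xE] : exists x, val A :&: val B = [set x].
  by apply/cards1P; have := cardsID (val B) (val A); rewrite AE cards1 cA addn1 => -[->].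
have abE : e a b.
  have ab : a != b.
    apply: contraTneq aA => ->; move: bB; rewrite !inE => /andP[/negPf->].
    by rewrite andbF.
  have := memab b; have := memab a; rewrite AE BE !inE !eqxx orbT /=.
  move=> /esym/orP[]/eqP aE /esym/orP[]/eqP bE; move: ab; rewrite aE bE ?eqxx // => _.
  by rewrite se.
exists x, a, b; split=> //.
- by rewrite -(setID (val A) (val B)) xE AE.
- by rewrite -(setID (val B) (val A)) setIC xE BE.
- apply: contraTneq aA => <-; have : x \in val A :&: val B by rewrite xE set11.
  by rewrite !inE => /andP[_ ->].
- apply: contraTneq bB => <-; have : x \in val A :&: val B by rewrite xE set11.
  by rewrite !inE => /andP[->].
Qed.

Lemma grid_adj_sym : symmetric grid_adj.
Proof. by move=> p q; rewrite /grid_adj orbA orbC !orbA -orbA. Qed.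

(** The moving token cannot jump over [x], so the order of the two tokens is kept and only one
    coordinate changes. *)
Lemma grid_adj_min_max x a : x != a -> x != a.+1 ->
  grid_adj (minn x a, maxn x a) (minn x a.+1, maxn x a.+1).
Proof.
rewrite /grid_adj /= !xpair_eqE => /negPf xa /negPf xa1; have [lt|] := boolP (x < a).
  have lt' := leqW lt; rewrite (minn_idPl (ltnW lt')) (maxn_idPr (ltnW lt')).
  by rewrite (minn_idPl (ltnW lt)) (maxn_idPr (ltnW lt)) !eqxx !orbT.
rewrite -leqNgt leq_eqVlt eq_sym xa /= => lt.
have := lt; rewrite leq_eqVlt eq_sym xa1 /= => lt'.
rewrite (minn_idPr (ltnW lt')) (maxn_idPl (ltnW lt')).
by rewrite (minn_idPr (ltnW lt)) (maxn_idPl (ltnW lt)) !eqxx.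
Qed.

Lemma two_token_path_planar (T : finType) (e : rel T) (n : nat) (phi : T -> 'I_n) :
  symmetric e -> injective phi -> (forall x y, e x y -> path_rel n (phi x) (phi y)) ->
  planar (token_rel e 2).
Proof.
move=> se phi_inj ephi.
pose M (A : token_vertex T 2) := \max_(x in val A) (phi x : nat).
(* The minimum is written as the sum minus the maximum, which depends on the set alone and on no
   enumeration of it. *)
pose q (A : token_vertex T 2) := ((\sum_(x in val A) (phi x : nat)) - M A, M A).
have qE (A : token_vertex T 2) x y : val A = [set x; y] -> x != y ->
    q A = (minn (phi x) (phi y), maxn (phi x) (phi y)).
  move=> AE xy; rewrite /q /M AE !big_setU1 ?inE //= !big_set1.
  by rewrite -(addn_min_max (phi x)) addnK.
have vphi x y : x != y -> phi x != phi y :> nat.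
  by apply: contra_neq => /val_inj/phi_inj.
apply: (@grid_planar _ _ q) => [A B|A B /(token_rel2P se)].
  have /cards2P[x [y [xy AE]]] := valP A.
  have /cards2P[x' [y' [xy' BE]]] := valP B.
  rewrite (qE _ _ _ AE xy) (qE _ _ _ BE xy') => -[Emin Emax].
  apply: val_inj; rewrite AE BE.
  have : (phi x = phi x' /\ phi y = phi y') \/ (phi x = phi y' /\ phi y = phi x').
    move: Emin Emax; rewrite /minn /maxn.
    by case: ltnP => _; case: ltnP => _ /val_inj E1 /val_inj E2; auto.
  by case=> -[/phi_inj-> /phi_inj->]; rewrite // setUC.
move=> [x [a [b [AE BE xa xb /ephi ab]]]].
rewrite (qE _ _ _ AE xa) (qE _ _ _ BE xb).
move: (vphi _ _ xa) (vphi _ _ xb); case/orP: ab => /eqP <- xa' xb'.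
  exact: grid_adj_min_max.
by rewrite grid_adj_sym; apply: grid_adj_min_max.
Qed.

(** * Paths, cycles and claws *)

(** These claws need not be induced: for a simple graph the condition says that all degrees are at
    most 2. *)
Definition claw_free (T : finType) (e : rel T) : Prop :=
  forall g, ~ tree_in e [:: 0; 0; 0] g.

Lemma claw_tree (T : eqType) (e : rel T) v x y z :
  e v x -> e v y -> e v z -> uniq [:: v; x; y; z] ->
  tree_in e [:: 0; 0; 0] [:: v; x; y; z].
Proof.
move=> vx vy vz; rewrite /= !inE !negb_or -!andbA.
move=> /and5P[nvx nvy nvz nxy /and3P[nxz nyz _]].
apply: (@Tree_leaf _ _ [:: 0; 0] [:: v; x; y] 0 z) => //; last first.
  by rewrite !inE !negb_or ![z == _]eq_sym nvz nxz.
apply: (@Tree_leaf _ _ [:: 0] [:: v; x] 0 y) => //; last first.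
  by rewrite !inE !negb_or ![y == _]eq_sym nvy.
apply: (@Tree_leaf _ _ [::] [:: v] 0 x) => //; last by rewrite inE eq_sym.
exact: Tree_root.
Qed.

Lemma claw_free_degree (T : finType) (e : rel T) v x y z :
  irreflexive e -> claw_free e -> e v x -> e v y -> e v z ->
  x != y -> x != z -> y != z -> False.
Proof.
move=> ie cf vx vy vz xy xz yz; apply: (cf [:: v; x; y; z]); apply: claw_tree => //=.
have ne u : e v u -> v != u by apply: contraTneq => <-; rewrite ie.
by rewrite !inE !negb_or !ne // xy xz yz.
Qed.

(** By connectedness some vertex of a shorter path has a neighbour outside it. At an end the path
    grows; at an inner vertex there would be a claw. *)
Lemma claw_free_path (T : finType) (e : rel T) m :
  irreflexive e -> symmetric e -> connected_graph e -> claw_free e ->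
  0 < m <= #|T| -> exists g, [/\ uniq g, size g = m & sorted e g].
Proof.
move=> ie se ce cf; elim: m => // -[_|m IH] /= mT.
  have /card_gt0P[x _] := mT.
  by exists [:: x].
have [g [ug sg pg]] := IH (ltnW mT).
have x0 : T by case: (g) sg => [|x].
have [|p [y [lt_p yg epy]]] := connected_extension x0 se ce ug; first by rewrite sg.
case: p lt_p epy => [|p] lt_p epy.
  exists (y :: g); split; rewrite /= ?yg ?sg //.
  by case: g lt_p epy pg {ug sg yg} => //= x g _; rewrite se => ->.
have [lt_p2|] := boolP (p.+2 < size g); last first.
  rewrite -leqNgt => ge_p; have pE : p.+2 = size g by apply/eqP; rewrite eqn_leq ge_p lt_p.
  exists (rcons g y); split; rewrite ?rcons_uniq ?yg ?size_rcons ?sg //.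
  case: g ug sg pg yg lt_p epy pE {ge_p} => //= x g _ _ pg _ _ epy [pE].
  by rewrite rcons_path pg (last_nth x0) -pE.
have /(sortedP x0) step := pg.
case: (@claw_free_degree _ e (nth x0 g p.+1) (nth x0 g p) (nth x0 g p.+2) y) => //.
- by rewrite se; apply: step.
- exact: step.
- by rewrite nth_uniq ?(ltnW (ltnW lt_p2)) // -addn2 -[X in X == _]addn0 eqn_add2l.
- by apply: contraNneq yg => <-; apply: mem_nth; apply: ltnW.
- by apply: contraNneq yg => <-; apply: mem_nth.
Qed.

(** Take a path through all vertices. A chord at an inner vertex gives that vertex a third
    neighbour, so only the two ends can be joined; whether they are decides between cycle and
    path. *)
Lemma claw_free_path_or_cycle (T : finType) (e : rel T) :
  irreflexive e -> symmetric e -> connected_graph e -> claw_free e -> 0 < #|T| ->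
  isomorphic e (path_rel #|T|) \/
  exists x0 g, size g = #|T| /\ copy x0 e g (cycle_rel #|T|).
Proof.
move=> ie se ce cf T0.
have [|g [ug sg pg]] := claw_free_path ie se ce cf (m := #|T|); first by rewrite T0 leqnn.
have /card_gt0P[x0 _] := T0.
have /(sortedP x0) step := pg.
have chord i j : i < j -> j < size g -> e (nth x0 g i) (nth x0 g j) ->
    j = i.+1 \/ (i = 0 /\ j.+1 = size g).
  move=> ij jg eij; have ig := ltn_trans ij jg.
  case: (eqVneq j i.+1) => [->|jN]; [by left|right].
  have ij1 : i.+1 < j by rewrite ltn_neqAle eq_sym jN.
  have nthN k l : k < l -> l < size g -> nth x0 g k != nth x0 g l.
    by move=> kl lg; rewrite nth_uniq ?(ltn_trans kl) // neq_ltn kl.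
  case: i ij ig eij jN ij1 => [|i] ij ig eij jN ij1.
    split=> //; apply/eqP; rewrite eqn_leq jg leqNgt; apply/negP=> jg1.
    case: j jg ij eij jN ij1 jg1 => // j jg _ eij _ ij1 jg1.
    case: (@claw_free_degree _ e (nth x0 g j.+1) (nth x0 g 0) (nth x0 g j) (nth x0 g j.+2)).
    - exact: ie.
    - exact: cf.
    - by rewrite se.
    - by rewrite se; apply: step.
    - exact: step.
    - by apply: nthN => //; apply: ltnW.
    - exact: nthN.
    - exact: nthN.
  case: (@claw_free_degree _ e (nth x0 g i.+1) (nth x0 g i) (nth x0 g i.+2) (nth x0 g j)).
  - exact: ie.
  - exact: cf.
  - by rewrite se; apply: step.
  - by apply: step; apply: leq_trans jg.
  - exact: eij.
  - by apply: nthN => //; apply: ltn_trans jg.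
  - by apply: nthN => //; apply: ltn_trans ij.
  - exact: nthN.
case last_edge : (e (nth x0 g 0) (nth x0 g #|T|.-1)); [right|left].
  exists x0, g; split=> //; split=> // i j ig jg; rewrite /cycle_rel -sg.
  move=> /or4P[/eqP E|/eqP E|/andP[/eqP-> /eqP E]|/andP[/eqP-> /eqP E]].
  - by rewrite -E; apply: step; rewrite E.
  - by rewrite -E se; apply: step; rewrite E.
  - by move: last_edge; rewrite -sg -E.
  - by move: last_edge; rewrite se -sg -E.
have memg x : x \in g.
  have /subset_cardP/(_ (subset_predT _)) : #|g| = #|T| by rewrite (card_uniqP ug).
  by move=> ->.
have idx x : index x g < #|T| by rewrite -sg index_mem.
exists (fun x => Ordinal (idx x)); split.
  exists (fun i : 'I_#|T| => nth x0 g i) => [x|i] /=; first by rewrite nth_index.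
  by apply: val_inj; rewrite /= index_uniq // sg.
move=> x y; rewrite /path_rel /=.
have edge z t : index z g < index t g -> e z t = ((index z g).+1 == index t g).
  move=> zt; apply/idP/eqP=> [ezt|ztE].
    have [||//|[z0 tn]] := chord _ _ zt; rewrite ?index_mem ?nth_index //.
    by move: last_edge; rewrite -sg -tn -z0 /= !nth_index // ezt.
  rewrite -(nth_index x0 (memg z)) -(nth_index x0 (memg t)) -ztE.
  by apply: step; rewrite ztE index_mem.
case: (ltngtP (index x g) (index y g)) => [lt|lt|E].
- by rewrite edge // (gtn_eqF (leqW lt)) orbF.
- by rewrite se edge // (gtn_eqF (leqW lt)).
- by rewrite -(nth_index x0 (memg x)) E nth_index // ie !(gtn_eqF (ltnSn _)).
Qed.

(** * Conclusion, first for 2k at most n and then by complementation *)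

Lemma token_planar_half (T : finType) (e : rel T) k :
  simple_graph e -> connected_graph e -> 10 < #|T| -> 2 <= k -> k.*2 <= #|T| ->
  planar (token_rel e k) -> k = 2 /\ isomorphic e (path_rel #|T|).
Proof.
move=> [ie se] ce T10 k2 kT pl.
have T0 : 0 < #|T| by apply: ltn_trans T10.
move: k2 kT pl; rewrite leq_eqVlt => /orP[/eqP<- _ pl|k3 kT pl]; last first.
  have /card_gt0P[x _] := T0.
  have [|b [g [bb tg]]] := unavoidable_tree_in se ce three_token_trees_unavoidable
    (mem_head _ _) (Tree_root e x); first by apply: ltn_trans T10.
  have g7 : size g <= 7.
    by rewrite (tree_in_size tg); apply: (allP (a := fun b => size b < 7)) bb; vm_compute.
  case: (certified_tree_nonplanar se three_token_trees_certified bb tg k3 _ pl).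
  (* The [k - 3] parked tokens fit outside 7 vertices: k > n - 4 would give 2k >= 2n - 6 > n. *)
  apply: leq_trans (leq_sub2l _ g7); rewrite leq_subLR leqNgt; apply/negP => lt_k.
  rewrite -leq_double in lt_k; have := leq_trans lt_k kT.
  have T7 : 7 <= #|T| by apply: ltn_trans T10.
  rewrite -addSn doubleD -[X in _ <= X -> _](subnKC T7) leqNgt => /negP; apply.
  by apply: (@leq_add 8 _ 8) => //; rewrite -addnn leq_addr.
split=> //.
(* A claw would grow into a certified tree; here j = k = 2, so no token has to be parked. *)
have cf : claw_free e.
  move=> g tg; have sg := tree_in_size tg.
  have [|b [g' [bb tg']]] := unavoidable_tree_in se ce two_token_trees_unavoidable
    (mem_head _ _) tg; first by rewrite sg.
  exact: (certified_tree_nonplanar se two_token_trees_certified bb tg' (leqnn _)) pl.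
have [//|[x0 [g [sg cg]]]] := claw_free_path_or_cycle ie se ce cf T0.
have T6 : 6 <= #|T| by apply: leq_trans T10.
case: (cycle_no_drawing T6); rewrite -{2}sg.
apply: (copy_token_drawing cg (leqnn 2)) (planar_parity_drawing pl) => //.
by rewrite sg; apply: leq_trans T6.
Qed.

Theorem theorem2 (T : finType) (e : rel T) (k : nat) :
  simple_graph e -> connected_graph e -> 10 < #|T| ->
  2 <= k <= #|T| - 2 ->
  (planar (token_rel e k) <->
   ((k = 2 \/ k = #|T| - 2) /\ isomorphic e (path_rel #|T|))).
Proof.
move=> sg ce T10 /andP[k2 kT].
have k_le : k <= #|T| by apply: leq_trans kT (leq_subr _ _).
split=> [pl|[k_eq [phi [phi_bij phiE]]]].
  have [half|half] := leqP k.*2 #|T|.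
    by have [-> iso] := token_planar_half sg ce T10 k2 half pl; split; [left|].
  have k2' : 2 <= #|T| - k by rewrite leq_subRL // addnC -leq_subRL // (leq_trans _ T10).
  have half' : (#|T| - k).*2 <= #|T|.
    by rewrite -addnn -leq_subRL ?leq_subr // subKn // leq_subLR addnn ltnW.
  have pl' : planar (token_rel e (#|T| - k)).
    by apply: planar_token_compl; rewrite subKn.
  have [kE iso] := token_planar_half sg ce T10 k2' half' pl'.
  by split=> //; right; rewrite -kE subKn.
have pl2 : planar (token_rel e 2).
  apply: (two_token_path_planar (proj2 sg) (bij_inj phi_bij)) => x y.
  by rewrite phiE.
by case: k_eq => ->; [|apply: planar_token_compl; rewrite subKn // (leq_trans _ T10)].
Qed.
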